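(* Let $\mathcal{M}=(S,\mathit{Act},\mathbf{P},s_I)$ be an MDP, $\mathcal{Q}=(\psi_1,\dots,\psi_\ell)$ a query with $\psi_j=\mathbb{E}_{\sim_j}(\mathbf{R}_j\lozenge G_j)$, and $\vec p\in\mathbb{R}^\ell$ (all entries finite). Assume (i) $\mathcal{M}$ has exactly one end component, and (ii) for every $j$, every state $s\in S$ and every pure stationary strategy $\sigma$, $\mathbb{E}^{\sigma}_{\mathcal{M}_s}(\mathbf{R}_j\lozenge G_j)<\infty$. Let $U_s^j\in\mathbb{Q}$ (for $s\in S^j_?$) be numbers with $U_s^j\ge \mathbb{E}^{\sigma}_{\mathcal{M}_s}(\mathbf{R}_j\lozenge G_j)$ for every strategy $\sigma$. Then the constraint system $\mathcal{C}_1$ described in the context has a solution if and only if $\vec p\in\mathrm{Ach}_{PS}(\mathcal{M},\mathcal{Q})$.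
   Context: MDP: $\mathcal{M}=(S,\mathit{Act},\mathbf{P},s_I)$, $S,\mathit{Act}$ finite, $\mathbf{P}\colon S\times\mathit{Act}\times S\to[0,1]$ with $\sum_{s'}\mathbf{P}(s,\alpha,s')\in\{0,1\}$; $\mathit{Act}(s)=\{\alpha\mid\exists s'.\mathbf{P}(s,\alpha,s')>0\}\neq\emptyset$; $\mathcal{M}_s$ is $\mathcal{M}$ with initial state $s$. A (general) strategy maps finite paths to distributions over actions enabled at the last state; a pure stationary strategy is $\sigma\colon S\to\mathit{Act}$ with $\sigma(s)\in\mathit{Act}(s)$; $\mathbb{E}^\sigma_{\mathcal{M}}$ is the expectation under the induced path measure. For reward structure $\mathbf{R}\colon S\times\mathit{Act}\times S\to\mathbb{R}_{\ge0}$, $G\subseteq S$ and path $\pi=s_0\alpha_1s_1\dots$, $(\mathbf{R}\lozenge G)(\pi)=\sum_{i=1}^{n}\mathbf{R}(s_{i-1},\alpha_i,s_i)$, $n$ the least index with $s_n\in G$ ($\infty$ if none). Objective $\psi_j=\mathbb{E}_{\sim_j}(\mathbf{R}_j\lozenge G_j)$, ${\sim_j}\in\{\ge,\le\}$ (maximizing if $\ge$, minimizing if $\le$). $\vec p$ is achieved by $\sigma$ if $\mathbb{E}^\sigma_{\mathcal{M}}(\mathbf{R}_j\lozenge G_j)\sim_j p_j$ for all $j$; $\mathrm{Ach}_{PS}(\mathcal{M},\mathcal{Q})$ is the set of points achieved by some pure stationary strategy. A set $\mathcal{E}\subseteq S\times\mathit{Act}$ is closed if for all $(s,\alpha)\in\mathcal{E}$,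 $\alpha\in\mathit{Act}(s)$ and every $s'$ with $\mathbf{P}(s,\alpha,s')>0$ lies in $S_{\mathcal{E}}=\{s\mid\exists\alpha.(s,\alpha)\in\mathcal{E}\}$; an end component is a nonempty closed $\mathcal{E}$ such that every $s'\in S_{\mathcal{E}}$ is reachable from every $s\in S_{\mathcal{E}}$ using only transitions $(t,\beta,t')$ with $(t,\beta)\in\mathcal{E}$ and $\mathbf{P}(t,\beta,t')>0$. Let $S_0^j=\{s\in S\mid \mathbb{E}^\sigma_{\mathcal{M}_s}(\mathbf{R}_j\lozenge G_j)=0\text{ for all strategies }\sigma\}$ and $S_?^j$ the set of states $s\notin S_0^j$ reachable from $s_I$ by a path visiting no state of $S_0^j$. For each $j$ put $\epsilon_j=1,\mu_j=0$ if $\sim_j$ is $\ge$, and $\epsilon_j=-1,\mu_j=1$ if $\sim_j$ is $\le$. The system $\mathcal{C}_1$ (mixed integer linear constraints) has variables $a_{s,\alpha}$ ($s\in S,\alpha\in\mathit{Act}(s)$), $x^j_s$ ($s\in S_0^j\cup S_?^j$), $x^j_{s,\alpha}$ ($s\in S^j_?,\alpha\in\mathit{Act}(s)$), and constraints: for all $s\in S$: $a_{s,\alpha}\in\{0,1\}$ and $\sum_{\alpha\in\mathit{Act}(s)}a_{s,\alpha}=1$; for all $j$: $x_s^j=0$ for $s\in S_0^j$; for all $j$, $s\in S_?^j$: $0\le\epsilon_jx^j_s\le U^j_s$, and for all $\alpha\in\mathit{Act}(s)$: $0\le\epsilon_jx^j_{s,\alpha}\le U^j_s$, $x^j_{s,\alpha}\le\sum_{s'\in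 S}\mathbf{P}(s,\alpha,s')\,(x^j_{s'}+\epsilon_j\mathbf{R}_j(s,\alpha,s'))$, $x^j_{s,\alpha}\le U^j_s(a_{s,\alpha}-\mu_j)$, and $x^j_s\le\sum_{\alpha\in\mathit{Act}(s)}x^j_{s,\alpha}+\mu_j(|\mathit{Act}(s)|-1)U^j_s$; finally for all $j$: $\epsilon_j x^j_{s_I}\sim_j p_j$. *)

(* Defs.v *)
From HB Require Import structures.
From mathcomp Require Import all_boot all_order all_algebra.
From mathcomp Require Import all_classical all_reals all_analysis.
From mathcomp Require Import ring lra.

Set Implicit Arguments.
Unset Strict Implicit.
Unset Printing Implicit Defensive.

Import Order.TTheory GRing.Theory Num.Theory.
Import numFieldNormedType.Exports.

Local Open Scope classical_set_scope.
Local Open Scope ring_scope.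

(* A stochastic process on a finite set X is given by the conditional law     *)
(* q h of the next letter after the finite history h. It is realized on       *)
(* [0, 1[ by successive subdivision: the points whose sequence of letters     *)
(* starts with w form an interval whose length is the probability of w.       *)
Section subdivision.
Variables (R : realType) (X : finType) (x0 : X) (q : seq X -> X -> R).
Hypothesis q_ge0 : forall h x, 0 <= q h x.
Hypothesis q_sum1 : forall h, \sum_x q h x = 1.

Fixpoint word_prob (h w : seq X) : R :=
  if w is x :: w' then q h x * word_prob (rcons h x) w' else 1.

Let lower h (x : X) : R := \sum_(y | (enum_rank y < enum_rank x)%N) q h y.

Fixpoint offset (h w : seq X) : R :=
  if w is x :: w' then lower h x + q h x * offset (rcons h x) w' else 0.

Let in_cell h (u : R) x := lower h x <= u < lower h x + q h x.

Definition letter h u : X := odflt x0 [pick x | in_cell h u x].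

Fixpoint letters (h : seq X) (u : R) (n : nat) : X :=
  let x := letter h u in
  if n is n'.+1 then letters (rcons h x) ((u - lower h x) / q h x) n' else x.

Let lower_ge0 h x : 0 <= lower h x.
Proof. exact: sumr_ge0. Qed.

Let lowerD_le1 h x : lower h x + q h x <= 1.
Proof.
rewrite -(q_sum1 h) [leRHS](bigD1 x)//= [leLHS]addrC lerD2l.
rewrite [leRHS](bigID (fun y => (enum_rank y < enum_rank x)%N))/=.
rewrite [X in _ <= X + _](_ : _ = lower h x).
  by rewrite /lower lerDl sumr_ge0.
apply: eq_bigl => y; rewrite andbC; case: eqVneq => [->|]; rewrite ?ltnn ?andbF ?andbT//.
Qed.

Let lowerD_le h x y : (enum_rank x < enum_rank y)%N ->
  lower h x + q h x <= lower h y.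
Proof.
move=> xy; rewrite [leRHS](bigD1 x)//= [leLHS]addrC lerD2l.
rewrite [leRHS](bigID (fun z => (enum_rank z < enum_rank x)%N))/=.
rewrite [X in _ <= X + _](_ : _ = lower h x).
  by rewrite /lower lerDl sumr_ge0.
apply: eq_bigl => z; case: (ltnP (enum_rank z) (enum_rank x)) => zx.
  rewrite (ltn_trans zx xy)/= andbT; apply: contraTneq zx => ->.
  by rewrite ltnn.
by rewrite andbF.
Qed.

Let in_cell_inj h u x y : in_cell h u x -> in_cell h u y -> x = y.
Proof.
move=> /andP[xu ux] /andP[yu uy].
case: (ltngtP (enum_rank x) (enum_rank y)) => [xy|yx|/ord_inj/enum_rank_inj//].
- by exfalso; have := lowerD_le h xy; lra.
- by exfalso; have := lowerD_le h yx; lra.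
Qed.

Let in_cell_ex h (u : R) : 0 <= u < 1 -> exists x, in_cell h u x.
Proof.
move=> /andP[u0 u1].
pose c k : R := \sum_(y | (enum_rank y < k)%N) q h y.
have ex : exists k, u < c k.
  exists #|X|; rewrite /c (eq_bigl xpredT) ?q_sum1//.
  by move=> y /=; rewrite ltn_ord.
have [[|k] uk mink] := ex_minnP ex.
  by move: uk; rewrite /c big_pred0 ?ltNge ?u0.
have cku : c k <= u.
  by rewrite leNgt; apply/negP => /mink; rewrite ltnn.
have kX : (k < #|X|)%N.
  rewrite ltnNge; apply/negP => Xk; move: cku; rewrite leNgt => /negP; apply.
  rewrite /c (eq_bigl xpredT) ?q_sum1// => y /=.
  by rewrite (leq_trans (ltn_ord _) Xk).
exists (enum_val (Ordinal kX)); rewrite /in_cell /lower enum_valK/= cku/=.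
rewrite (lt_le_trans uk)// /c (bigD1 (enum_val (Ordinal kX))) ?enum_valK//=.
rewrite [leRHS]addrC lerD2l le_eqVlt; apply/orP; left; apply/eqP; apply: eq_bigl => y.
rewrite ltnS leq_eqVlt; case: (eqVneq y (enum_val _)) => [->|ne].
  by rewrite enum_valK/= ltnn andbF.
rewrite andbT; case: eqP => //= yk; case/eqP: ne; apply: enum_rank_inj.
by rewrite enum_valK; apply: ord_inj.
Qed.

Let letterP h (u : R) x : 0 <= u < 1 -> (letter h u == x) = in_cell h u x.
Proof.
move=> u01; rewrite /letter; case: pickP => [y yu|no]/=; last first.
  by have [z zu] := in_cell_ex h u01; have := no z; rewrite zu.
by apply/eqP/idP => [<-//|xu]; exact: in_cell_inj yu xu.
Qed.

Lemma word_prob_ge0 h w : 0 <= word_prob h w.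
Proof. by elim: w h => //= x w IH h; rewrite mulr_ge0. Qed.

Lemma offset_ge0 h w : 0 <= offset h w.
Proof. by elim: w h => //= x w IH h; rewrite addr_ge0 ?mulr_ge0. Qed.

Lemma offsetD_le1 h w : offset h w + word_prob h w <= 1.
Proof.
elim: w h => /= [|x w IH] h; first by rewrite add0r.
rewrite -addrA -mulrDr; apply: le_trans (lowerD_le1 h x); rewrite lerD2l.
by rewrite ler_piMr.
Qed.

Lemma lettersP h w (u : R) : 0 <= u < 1 ->
  (mkseq (letters h u) (size w) == w) =
  (offset h w <= u < offset h w + word_prob h w).
Proof.
elim: w h u => [|x w IH] h u u01; first by rewrite /= add0r u01.
have -> : mkseq (letters h u) (size (x :: w)) =
    letter h u :: mkseq (letters (rcons h (letter h u))
      ((u - lower h (letter h u)) / q h (letter h u))) (size w).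
  by rewrite /mkseq/= -[1%N]addn0 iotaDl -map_comp.
rewrite eqseq_cons letterP//=.
have lw := offset_ge0 (rcons h x) w; have lpw := offsetD_le1 (rcons h x) w.
have pw := word_prob_ge0 (rcons h x) w.
have [xu|xu]/= := boolP (in_cell h u x); last first.
  apply/esym/negbTE; apply: contra xu => /andP[a b]; rewrite /in_cell.
  by have q0 := q_ge0 h x; apply/andP; split; nra.
have /eqP -> : letter h u == x by rewrite letterP.
move: xu => /andP[xu ux].
have qx : 0 < q h x by lra.
rewrite IH ?ler_pdivlMr ?ltr_pdivrMr//; last first.
  by rewrite mul0r mul1r; apply/andP; split; lra.
by congr (_ && _); apply/idP/idP => ?; lra.
Qed.

End subdivision.


Section uniform01.
Variable R : realType.

Let m01 : measurable (`[0, 1[%classic : set (measurableTypeR R)).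
Proof. exact: measurable_itv. Qed.

Definition uniform01 : set (measurableTypeR R) -> \bar R :=
  mrestr lebesgue_measure m01.

HB.instance Definition _ := Measure.on uniform01.

Let uniform01_setT : uniform01 setT = 1%E.
Proof.
rewrite /uniform01 /mrestr setTI lebesgue_measure_itv/= lte_fin ltr01.
by rewrite oppr0 adde0.
Qed.

HB.instance Definition _ :=
  Measure_isProbability.Build _ _ _ uniform01 uniform01_setT.

End uniform01.

Record mdp (R : realType) := MDP {
  state : finType;
  action : finType;
  trans : state -> action -> state -> R;
  init : state;
  trans01 : forall s a t, 0 <= trans s a t <= 1;
  trans_sum : forall s a, \sum_t trans s a t = 0 \/ \sum_t trans s a t = 1;
  exists_enabled : forall s, exists a, exists t, 0 < trans s a t }.

Section mdp_definitions.
Variables (R : realType) (M : mdp R).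

Definition enabled (s : state M) : {set action M} :=
  [set a | [exists t, 0 < trans s a t]].

Definition step := (action M * state M)%type.

HB.instance Definition _ := Finite.on step.

Lemma step_inhabited : exists _ : step, True.
Proof. by have [a _] := exists_enabled (init M); exists (a, init M). Qed.

HB.instance Definition _ := isPointed.Build step (sval (cid step_inhabited)).

(* The finite path s_0 a_1 s_1 ... a_n s_n is represented by s_0 together     *)
(* with h = [:: (a_1, s_1); ...; (a_n, s_n)], an infinite one by s_0 together *)
(* with a function nat -> step.                                               *)
Definition last_state (s : state M) (h : seq step) : state M :=
  last s (unzip2 h).

(* The values at sequences with a transition of probability 0, which are not  *)
(* paths of M, are irrelevant.                                                *)
Record strategy := Strategy {
  strategy_fun :> state M -> seq step -> action M -> R;
  strategy_ge0 : forall s h a, 0 <= strategy_fun s h a;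
  strategy_sum1 : forall s h, \sum_a strategy_fun s h a = 1;
  strategy_enabled : forall s h a,
    a \notin enabled (last_state s h) -> strategy_fun s h a = 0 }.

Record ps_strategy := PSStrategy {
  ps_action :> state M -> action M;
  ps_enabled : forall s, ps_action s \in enabled s }.

Program Definition strategy_of_ps (sigma : ps_strategy) : strategy :=
  @Strategy (fun s h a => (a == sigma (last_state s h))%:R) _ _ _.
Next Obligation. by []. Qed.
Next Obligation.
move=> sigma s h; rewrite (bigD1 (sigma (last_state s h)))//= eqxx big1 ?addr0//.
by move=> a /negbTE ->.
Qed.
Next Obligation.
move=> sigma s h a; apply: contraNeq.
by rewrite pnatr_eq0 eqb0 negbK => /eqP ->; exact: ps_enabled.
Qed.

Definition step_prob (sigma : strategy) (s : state M) (h : seq step)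
    (e : step) : R :=
  sigma s h e.1 * trans (last_state s h) e.1 e.2.

Lemma step_prob_ge0 sigma s h e : 0 <= step_prob sigma s h e.
Proof.
apply: mulr_ge0; first exact: strategy_ge0.
by have /andP[] := trans01 (last_state s h) e.1 e.2.
Qed.

Lemma trans_sum1 (s : state M) a : a \in enabled s -> \sum_t trans s a t = 1.
Proof.
rewrite inE => /existsP[t at0]; have [/eqP|//] := trans_sum s a.
rewrite psumr_eq0 => [/allP/(_ t)|u _]; last by have /andP[] := trans01 s a u.
by rewrite mem_index_enum gt_eqF//= => /(_ isT).
Qed.

Lemma step_prob_sum1 sigma s h : \sum_e step_prob sigma s h e = 1.
Proof.
rewrite /step_prob.
rewrite -(pair_bigA _
  (fun a t => sigma s h a * trans (last_state s h) a t))/=.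
rewrite -[RHS](strategy_sum1 sigma s h); apply: eq_bigr => a _.
rewrite -mulr_sumr; have [ea|na] := boolP (a \in enabled (last_state s h)).
  by rewrite trans_sum1// mulr1.
by rewrite strategy_enabled// mul0r.
Qed.

Definition cylinder (w : seq step) : set (nat -> step) :=
  [set omega | mkseq omega (size w) = w].

Local Notation path_space := (g_sigma_algebraType (range cylinder)).

(* The value of the measure on the cylinder of the finite path                *)
(* s a_1 s_1 ... a_n s_n is the product over i of                             *)
(* sigma(s ... s_(i-1))(a_i) * P(s_(i-1), a_i, s_i).                          *)
Definition is_path_measure (sigma : strategy) (s : state M)
    (mu : probability path_space R) : Prop :=
  forall w, mu (cylinder w) = (word_prob (step_prob sigma s) [::] w)%:E.

Lemma path_measure_exists sigma s : exists mu, is_path_measure sigma s mu.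
Proof.
pose q := step_prob sigma s.
have q0 : forall h e, 0 <= q h e by exact: step_prob_ge0.
have q1 : forall h, \sum_e q h e = 1 by exact: step_prob_sum1.
pose clip (u : R) : R := if 0 <= u < 1 then u else 0.
have clip01 u : 0 <= clip u < 1.
  by rewrite /clip; case: ifPn => // _; rewrite lexx ltr01.
pose f (u : measurableTypeR R) : path_space :=
  letters (point : step) q [::] (clip u).
pose J w : interval R :=
  `[offset q [::] w, offset q [::] w + word_prob q [::] w[.
have fE w : f @^-1` cylinder w = clip @^-1` [set` J w].
  apply/seteqP; split => u /=.
    by move/eqP; rewrite lettersP// in_itv.
  by rewrite in_itv/= => uJ; apply/eqP; rewrite lettersP.
have mclip : measurable_fun [set: R] clip.
  rewrite /clip; apply: measurable_fun_ifT => //; apply: measurable_and => //.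
  - exact: measurable_realfun.measurable_fun_ler.
  - exact: measurable_realfun.measurable_fun_ltr.
have mf : measurable_fun setT f.
  apply: (@measurability _ _ _ path_space setT f (range cylinder)) => //.
  by move=> _ [_ [w _ <-] <-]; rewrite fE; exact: mclip.
pose X : {mfun measurableTypeR R >-> path_space} := mfun_Sub (mem_set mf).
exists (distribution (@uniform01 R) X) => w.
rewrite /distribution /pushforward/= fE /uniform01 /mrestr.
have -> : clip @^-1` [set` J w] `&` `[0, 1[ = [set` J w].
  have o0 := offset_ge0 q0 [::] w; have o1 := offsetD_le1 q0 q1 [::] w.
  apply/seteqP; split => u /=; rewrite /clip !in_itv/=.
    by move=> [+ u01]; rewrite u01.
  by move=> /andP[ou uo]; have -> : 0 <= u < 1; [apply/andP; split; lra|rewrite ou uo].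
rewrite lebesgue_measure_itv/= lte_fin ltrDl -EFinB addrAC subrr add0r.
case: ltP => // w0; congr EFin; apply/eqP.
by rewrite eq_le w0 word_prob_ge0.
Qed.

Lemma path_measure_unique sigma s mu nu :
  is_path_measure sigma s mu -> is_path_measure sigma s nu ->
  forall A : set path_space, measurable A -> mu A = nu A.
Proof.
move=> muP nuP A mA; pose G := range cylinder `|` [set set0].
have cyl0 : cylinder [::] = setT by apply/seteqP; split.
apply: (@g_sigma_algebra_measure_unique _ R path_space G _ (fun=> setT)) => //.
- move=> _ [[w _ <-]|->]; last exact: measurable0.
  by apply: sub_sigma_algebra; exists w.
- by move=> _; left; exists [::].
- by rewrite bigcup_const//; exists 0%N.
- move=> B C [[v _ <-]|->]; last by rewrite set0I; right.
  move=> [[w _ <-]|->]; last by rewrite setI0; right.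
  wlog vw : v w / (size v <= size w)%N => [wl|].
    have [vw|/ltnW wv] := leqP (size v) (size w); first exact: wl.
    by rewrite setIC; exact: wl.
  have takeE (om : nat -> step) : mkseq om (size w) = w ->
      mkseq om (size v) = take (size v) w.
    by move=> <-; rewrite /mkseq -map_take take_iota (minn_idPl vw).
  have [vwE|vwN] := eqVneq (take (size v) w) v.
    left; exists w => //; apply/seteqP; split => om /=; last by case.
    by move=> omw; split => //; rewrite /cylinder/= takeE.
  right; apply/seteqP; split => om //= -[omv omw].
  by move: vwN; rewrite -(takeE om)// omv eqxx.
- move=> _ [[w _ <-]|->]; last by rewrite !measure0.
  exact: etrans (muP w) (esym (nuP w)).
- by move=> _; rewrite /= probability_setT ltry.
- move: A mA; apply: smallest_sub; first exact: smallest_sigma_algebra.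
  by move=> _ [w _ <-]; apply: sub_sigma_algebra; left; exists w.
Qed.

Definition path_measure sigma s : probability path_space R :=
  sval (cid (path_measure_exists sigma s)).

Lemma path_measureP sigma s : is_path_measure sigma s (path_measure sigma s).
Proof. exact: svalP. Qed.

Definition path_state (s : state M) (omega : path_space) (n : nat) : state M :=
  if n is n'.+1 then (omega n').2 else s.

Variant cmp_op := Geq | Leq.

Record objective := Objective {
  obj_cmp : cmp_op;
  reward : state M -> action M -> state M -> R;
  reward_ge0 : forall s a t, 0 <= reward s a t;
  goal : {set state M} }.

Definition reach_reward (psi : objective) (s : state M) (omega : path_space) :
    \bar R :=
  if pselect (exists n, path_state s omega n \in goal psi) is left ex then
    (\sum_(i < ex_minn ex) reward psi (path_state s omega i) (omega i).1
                                      (path_state s omega i.+1))%:E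
  else +oo%E.

(* Expectation in M with initial state s. *)
Definition expected (sigma : strategy) (s : state M) (psi : objective) :
    \bar R :=
  (\int[path_measure sigma s]_omega reach_reward psi s omega)%E.

Definition cmp_holds (d : Order.disp_t) (T : porderType d) (c : cmp_op)
    (x y : T) : bool :=
  if c is Geq then (y <= x)%O else (x <= y)%O.

Definition achievable_ps (l : nat) (Q : 'I_l -> objective) : set ('I_l -> R) :=
  [set p | exists sigma : ps_strategy, forall j,
     cmp_holds (obj_cmp (Q j))
       (expected (strategy_of_ps sigma) (init M) (Q j)) (p j)%:E].

Definition ec_states (E : {set state M * action M}) : {set state M} :=
  [set s | [exists a, (s, a) \in E]].

Definition closed_ec (E : {set state M * action M}) : Prop :=
  forall s a, (s, a) \in E ->
    a \in enabled s /\ (forall t, 0 < trans s a t -> t \in ec_states E).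

Definition ec_edge (E : {set state M * action M}) : rel (state M) :=
  fun t t' => [exists b, ((t, b) \in E) && (0 < trans t b t')].

Definition end_component (E : {set state M * action M}) : Prop :=
  [/\ E != finset.set0, closed_ec E &
      forall s s', s \in ec_states E -> s' \in ec_states E ->
        connect (ec_edge E) s s'].

Definition S_zero (psi : objective) : set (state M) :=
  [set s | forall sigma : strategy, expected sigma s psi = 0%E].

Definition edge : rel (state M) :=
  fun t t' => [exists a, 0 < trans t a t'].

Definition S_unknown (psi : objective) : set (state M) :=
  [set s | ~ S_zero psi s /\
     exists w : seq (state M),
       [/\ path edge (init M) w, last (init M) w = s &
           forall t, t \in init M :: w -> ~ S_zero psi t]].

Definition cmp_eps (c : cmp_op) : R := if c is Geq then 1 else -1.
Definition cmp_mu (c : cmp_op) : R := if c is Geq then 0 else 1.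

(* The arguments a, x and xa are total functions; their values outside the    *)
(* index sets of the variables do not matter: if s is in S_unknown psi and    *)
(* x j s' occurs below with a nonzero coefficient trans s b s', then s' is in *)
(* S_zero psi or S_unknown psi.                                               *)
Record C1_solution (l : nat) (Q : 'I_l -> objective) (p : 'I_l -> R)
    (U : 'I_l -> state M -> rat)
    (a : state M -> action M -> R)
    (x : 'I_l -> state M -> R)
    (xa : 'I_l -> state M -> action M -> R) : Prop := C1Solution {
  C1_bool : forall s b, b \in enabled s -> a s b = 0 \/ a s b = 1;
  C1_one : forall s, \sum_(b in enabled s) a s b = 1;
  C1_zero : forall j s, S_zero (Q j) s -> x j s = 0;
  C1_bound : forall j s, S_unknown (Q j) s ->
    0 <= cmp_eps (obj_cmp (Q j)) * x j s <= ratr (U j s);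
  C1_bounda : forall j s b, S_unknown (Q j) s -> b \in enabled s ->
    0 <= cmp_eps (obj_cmp (Q j)) * xa j s b <= ratr (U j s);
  C1_step : forall j s b, S_unknown (Q j) s -> b \in enabled s ->
    xa j s b <= \sum_s' trans s b s' *
                  (x j s' + cmp_eps (obj_cmp (Q j)) * reward (Q j) s b s');
  C1_select : forall j s b, S_unknown (Q j) s -> b \in enabled s ->
    xa j s b <= ratr (U j s) * (a s b - cmp_mu (obj_cmp (Q j)));
  C1_sum : forall j s, S_unknown (Q j) s ->
    x j s <= \sum_(b in enabled s) xa j s b +
             cmp_mu (obj_cmp (Q j)) * (#|enabled s|%:R - 1) * ratr (U j s);
  C1_point : forall j,
    cmp_holds (obj_cmp (Q j)) (cmp_eps (obj_cmp (Q j)) * x j (init M)) (p j) }.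

End mdp_definitions.

Notation path_space M := (g_sigma_algebraType (range (@cylinder _ M))).

(* Main.v *)
Require Import Defs.
From HB Require Import structures.
From mathcomp Require Import all_boot all_order all_algebra.
From mathcomp Require Import all_classical all_reals all_analysis.
From mathcomp Require Import measurable_realfun ring lra.

(* For a pure stationary strategy sigma, the expected rewards v satisfy the   *)
(* Bellman equation v s = sum_t P(s, sigma s, t) (v t + R(s, sigma s, t)) off *)
(* the goal; it is obtained by writing the path measure as the mixture, over  *)
(* the first step, of the path measures from the successors. If sigma achieves*)
(* p, then x = eps v solves C1; when minimizing, the constraint for an action *)
(* b that is not selected holds because playing b once and sigma afterwards is*)
(* a strategy, so that its expected reward is bounded by U. Conversely, a     *)
(* solution selects some sigma, and d = x - eps v is subharmonic along sigma  *)
(* on S_unknown and 0 on S_zero. The states maximizing d, if the maximum were *)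
(* positive, would form a set closed under sigma and disjoint from the goal,  *)
(* where the expected reward is infinite; hence d <= 0.                       *)

Set Implicit Arguments.
Unset Strict Implicit.
Unset Printing Implicit Defensive.

Import Order.TTheory GRing.Theory Num.Theory.

Local Open Scope classical_set_scope.
Local Open Scope ring_scope.

(** The binaries of a solution of C1 select a pure stationary [sigma] ([C1_select_ps]), and the
    other constraints reduce to [x] lying below its image under the Bellman operator of [sigma],
    with the sign [eps] treating both kinds of objective alike ([C1_solution_bellman]). The vector
    [eps v] is a fixed point of that operator off the goal ([value_step]), and [max_principle]
    yields [x <= eps v]: finite expected rewards exclude the traps of [expected_trap], so no larger
    [x] exists. Conversely [eps v] solves the system, and [expected_deviate] bounds the rows of the
    actions not selected. Both Bellman facts are instances of [expected_first_step]. *)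

(** * Measurability of the accumulated reward, and prefixing a step to a path *)

Section path_space_theory.
Variables (R : realType) (M : mdp R).
Implicit Types (s t : state M) (e : step M) (omega : path_space M)
  (sigma tau : strategy M) (psi : objective M).

Lemma measurable_cylinder (w : seq (step M)) :
  measurable (cylinder w : set (path_space M)).
Proof. by apply: sub_sigma_algebra; exists w. Qed.

(** Such a set is the union of the cylinders it contains, and there are only countably many finite
    words. *)
Lemma measurable_prefix_determined (A : set (path_space M)) :
  (forall omega, A omega -> exists n, forall omega',
     mkseq omega' n = mkseq omega n -> A omega') ->
  measurable A.
Proof.
move=> Apre; pose W w := cylinder w `<=` A.
have -> : A = \bigcup_w (if `[< W w >] then cylinder w else set0).
  apply/seteqP; split => omega.
    move=> /Apre[n An]; exists (mkseq omega n) => //.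
    have Wn : W (mkseq omega n).
      by move=> omega'; rewrite /cylinder/= size_mkseq => /An.
    by rewrite (asboolT Wn)/= /cylinder/= size_mkseq.
  by move=> [w _]; case: asboolP => // Ww; exact: Ww.
apply: countable_bigcupT_measurable => // w.
by case: asboolP => _; [exact: measurable_cylinder|exact: measurable0].
Qed.

Lemma eq_mkseq_nth (T : Type) (f g : nat -> T) n i :
  mkseq f n = mkseq g n -> (i < n)%N -> f i = g i.
Proof. by move=> fg iltn; rewrite -(nth_mkseq (f i) f iltn) fg nth_mkseq. Qed.

Lemma path_state_prefix s omega omega' n i : mkseq omega' n = mkseq omega n ->
  (i <= n)%N -> path_state s omega' i = path_state s omega i.
Proof. by move=> eqn; case: i => //= i iltn; rewrite (eq_mkseq_nth eqn iltn). Qed.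

Lemma reach_reward_first psi s omega n : path_state s omega n \in goal psi ->
  (forall i, (i < n)%N -> path_state s omega i \notin goal psi) ->
  reach_reward psi s omega =
  (\sum_(i < n) reward psi (path_state s omega i) (omega i).1
     (path_state s omega i.+1))%:E.
Proof.
move=> nG nfirst; rewrite /reach_reward; case: pselect => [ex|[]]; last by exists n.
case: ex_minnP => m mG mmin; suff -> : m = n by [].
apply/eqP; rewrite eqn_leq mmin//= leqNgt; apply/negP => mn.
by have := nfirst _ mn; rewrite mG.
Qed.

Lemma reach_reward_never psi s omega :
  ~ (exists n, path_state s omega n \in goal psi) ->
  reach_reward psi s omega = +oo%E.
Proof. by rewrite /reach_reward; case: pselect. Qed.

Lemma first_hit psi s omega : (exists n, path_state s omega n \in goal psi) ->
  exists2 n, path_state s omega n \in goal psi &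
    forall i, (i < n)%N -> path_state s omega i \notin goal psi.
Proof.
move=> ex; case: (ex_minnP ex) => n nG nmin; exists n => // i iltn.
by apply/negP => /nmin; rewrite leqNgt iltn.
Qed.

Lemma reach_reward_ge0 psi s omega : (0 <= reach_reward psi s omega)%E.
Proof.
rewrite /reach_reward; case: pselect => [ex|//]; rewrite lee_fin sumr_ge0// => i _.
exact: reward_ge0.
Qed.

Lemma measurable_hit psi s :
  measurable [set omega : path_space M | exists n, path_state s omega n \in goal psi].
Proof.
apply: measurable_prefix_determined => omega [n nG]; exists n => omega' eqn.
by exists n; rewrite (path_state_prefix s eqn).
Qed.

Lemma measurable_reach_reward psi s :
  measurable_fun [set: path_space M] (reach_reward psi s).
Proof.
move=> _ Y mY; rewrite setTI.
pose H := [set omega : path_space M | exists n, path_state s omega n \in goal psi].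
have -> : reach_reward psi s @^-1` Y =
    (H `&` reach_reward psi s @^-1` Y) `|` (~` H `&` [set _ | Y +oo%E]).
  apply/seteqP; split => omega /=.
    by have [Ho|Ho] := pselect (H omega); [left|right; rewrite -(reach_reward_never Ho)].
  by move=> [[]//|[Ho]]; rewrite /preimage/= (reach_reward_never Ho).
apply: measurableU.
  (* The prefix up to the first visit to the goal fixes the reward, so on hitting paths any
     preimage, even of a non-measurable set, is a union of cylinders. *)
  apply: measurable_prefix_determined => omega [/first_hit[n nG nfirst]] Yo.
  exists n => omega' eqn; have st i := path_state_prefix s eqn (i := i).
  have nG' : path_state s omega' n \in goal psi by rewrite st.
  split; first by exists n.
  rewrite /preimage/= (reach_reward_first nG'); last first.
    by move=> i iltn; rewrite st 1?ltnW// nfirst.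
  move: Yo; rewrite /preimage/= (reach_reward_first nG nfirst).
  congr (Y _%:E); apply: eq_bigr => i _.
  by rewrite (eq_mkseq_nth eqn (ltn_ord i)) !st// ltnW.
apply: measurableI; first by apply: measurableC; exact: measurable_hit.
have [Yoo|Yoo] := pselect (Y +oo%E).
  by rewrite (_ : [set _ | _] = setT)//; apply/seteqP; split.
by rewrite (_ : [set _ | _] = set0)//; apply/seteqP; split.
Qed.

Definition path_cons e omega : path_space M :=
  fun n => if n is n'.+1 then omega n' else e.

Lemma mkseq_path_cons e omega n :
  mkseq (path_cons e omega) n.+1 = e :: mkseq omega n.
Proof. by rewrite /mkseq/= -[1%N]addn0 iotaDl -map_comp. Qed.

Lemma preimage_path_cons e e' w :
  path_cons e @^-1` cylinder (e' :: w) = if e == e' then cylinder w else set0.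
Proof.
apply/seteqP; split => omega; rewrite /preimage /cylinder/= -/(mkseq _ _) mkseq_path_cons.
  by move=> [<- <-]; rewrite eqxx size_mkseq.
by case: eqP => // -> <-; rewrite size_mkseq.
Qed.

Lemma measurable_path_cons e : measurable_fun [set: path_space M] (path_cons e).
Proof.
apply: (@measurability _ _ _ (path_space M) setT _ (range (@cylinder R M))) => //.
move=> _ [_ [[|e' w] _ <-] <-]; rewrite setTI.
  rewrite (_ : _ @^-1` _ = setT); first exact: measurableT.
  by apply/seteqP; split.
rewrite preimage_path_cons; case: eqP => _; last exact: measurable0.
exact: measurable_cylinder.
Qed.

Definition path_cons_mfun e : {mfun path_space M >-> path_space M} :=
  mfun_Sub (mem_set (measurable_path_cons e)).

Lemma path_state_cons s e omega n :
  path_state s (path_cons e omega) n.+1 = path_state e.2 omega n.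
Proof. by case: n. Qed.

Lemma reach_reward_cons psi s e omega : s \notin goal psi ->
  reach_reward psi s (path_cons e omega) =
  ((reward psi s e.1 e.2)%:E + reach_reward psi e.2 omega)%E.
Proof.
move=> sG; have [ex|nex] :=
  pselect (exists n, path_state e.2 omega n \in goal psi).
  have [n nG nfirst] := first_hit ex.
  rewrite (reach_reward_first nG nfirst) (@reach_reward_first _ _ _ n.+1).
  - rewrite big_ord_recl -EFinD; congr (_ + _)%:E.
    by apply: eq_bigr => i _; rewrite lift0 !path_state_cons.
  - by rewrite path_state_cons.
  - by move=> [|i]// iltn; rewrite path_state_cons nfirst.
rewrite !reach_reward_never// => -[[|n]]; first by rewrite /= (negbTE sG).
by rewrite path_state_cons => nG; apply: nex; exists n.
Qed.

Lemma expected_ge0 sigma s psi : (0 <= expected sigma s psi)%E.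
Proof. by apply: integral_ge0 => omega _; exact: reach_reward_ge0. Qed.

Lemma expected_goal sigma s psi : s \in goal psi -> expected sigma s psi = 0%E.
Proof.
move=> sG; rewrite /expected; apply: integral0_eq => omega _.
by rewrite (@reach_reward_first _ _ _ 0%N)// big_ord0.
Qed.

End path_space_theory.

(** * Conditioning on the first step *)

Section first_step.
Variables (R : realType) (M : mdp R) (tau sigma : strategy M) (s : state M).
(** After one step, [tau] behaves as [sigma] started afresh. This covers both a stationary
    [tau = sigma] and a deviation from it in the first step only. *)
Hypothesis tau_after :
  forall e h, step_prob tau s (e :: h) = step_prob sigma e.2 h.

Let q e := step_prob tau s [::] e.

(** The steps are numbered because [msum] adds up a sequence of measures; the default of [nth] is
    never reached below [#|step M|]. *)
Let mixed (n : nat) : {measure set (path_space M) -> \bar R} :=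
  let e := nth (point : step M) (enum (step M : finType)) n in
  mscale (NngNum (step_prob_ge0 tau s [::] e))
    (distribution (path_measure sigma e.2) (path_cons_mfun e)).

Let mixture : set (path_space M) -> \bar R := msum mixed #|step M : finType|.

HB.instance Definition _ := Measure.on mixture.

Let sum_nth_enum (F : step M -> \bar R) :
  (\sum_(n < #|step M : finType|)
     F (nth (point : step M) (enum (step M : finType)) n) = \sum_e F e)%E.
Proof.
by rewrite -[RHS]big_enum (big_nth (point : step M)) -cardE big_mkord.
Qed.

Let mixtureE A : mixture A = (\sum_e (q e)%:E *
  path_measure sigma e.2 (path_cons e @^-1` A))%E.
Proof. by rewrite -sum_nth_enum. Qed.

Let mixture_setT : mixture setT = 1%E.
Proof.
rewrite mixtureE -(step_prob_sum1 tau s [::]) -sumEFin; apply: eq_bigr => e _.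
by rewrite preimage_setT probability_setT mule1.
Qed.

HB.instance Definition _ :=
  Measure_isProbability.Build _ _ _ mixture mixture_setT.

Lemma word_prob_after e h w :
  word_prob (step_prob tau s) (e :: h) w = word_prob (step_prob sigma e.2) h w.
Proof. by elim: w h => //= e' w IH h; rewrite IH tau_after. Qed.

Let mixture_path_measure : is_path_measure tau s mixture.
Proof.
move=> [|e w].
  rewrite (_ : cylinder [::] = setT) ?mixture_setT//.
  by apply/seteqP; split.
apply: etrans (mixtureE _) _; rewrite (bigD1 e)//= preimage_path_cons eqxx path_measureP.
rewrite word_prob_after big1 ?adde0// => e' e'e.
by rewrite preimage_path_cons (negbTE e'e) measure0 mule0.
Qed.

Lemma expected_first_step psi : s \notin goal psi ->
  expected tau s psi = (\sum_e (step_prob tau s [::] e)%:E *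
    ((reward psi s e.1 e.2)%:E + expected sigma e.2 psi))%E.
Proof.
move=> sG; have mf := @measurable_reach_reward R M psi.
have f0 t omega : (0 <= reach_reward psi t omega)%E := reach_reward_ge0 _ _ _.
rewrite /expected (eq_measure_integral mixture); last first.
  by move=> A mA _; exact: path_measure_unique (path_measureP _ _) mixture_path_measure _ mA.
rewrite ge0_integral_measure_sum// -sum_nth_enum; apply: eq_bigr => n _.
rewrite ge0_integral_mscale//; congr (_ * _)%E.
set e := nth _ _ _; rewrite ge0_integral_pushforward//.
rewrite preimage_setT; under eq_integral do rewrite /= reach_reward_cons//.
rewrite ge0_integralD//; last by move=> *; rewrite lee_fin reward_ge0.
by rewrite integral_cst// [X in (_ * X + _)%E]probability_setT mule1.
Qed.

End first_step.

(** * Bellman equation and maximum principle for a pure stationary strategy *)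

Section stationary.
Variables (R : realType) (M : mdp R) (sigma : ps_strategy M).
Implicit Types (s t : state M) (psi : objective M).

Lemma trans_ge0 s b t : 0 <= trans s b t.
Proof. by have /andP[] := trans01 s b t. Qed.

(** The first step out of [C] either uses an action other than that of [sigma] or has transition
    probability 0, so a factor of the product vanishes. *)
Lemma word_prob_leave (C : pred (state M)) s h w :
  (forall t t', C t -> 0 < trans t (sigma t) t' -> C t') ->
  C (last_state s h) -> ~~ all C (unzip2 w) ->
  word_prob (step_prob (strategy_of_ps sigma) s) h w = 0.
Proof.
move=> Cclosed; elim: w h => //= e w IH h Ch.
have [Ce|Ce] /= := boolP (C e.2).
  by move=> ?; rewrite IH ?mulr0//= /last_state /unzip2 map_rcons last_rcons.
move=> _; rewrite /step_prob/=; case: eqP => [->|_]; last by rewrite !mul0r.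
suff /eqP -> : trans (last_state s h) (sigma (last_state s h)) e.2 == 0.
  by rewrite mulr0 mul0r.
rewrite eq_le trans_ge0 andbT leNgt; apply: contra Ce; exact: Cclosed.
Qed.

Lemma expected_trap psi (C : pred (state M)) s :
  (forall t t', C t -> 0 < trans t (sigma t) t' -> C t') ->
  (forall t, C t -> t \notin goal psi) -> C s ->
  expected (strategy_of_ps sigma) s psi = +oo%E.
Proof.
move=> Cclosed CG Cs; pose mu := path_measure (strategy_of_ps sigma) s.
pose null (w : seq (step M)) := word_prob (step_prob (strategy_of_ps sigma) s) [::] w == 0.
(* These are the cylinders of probability 0, enumerated through [unpickle]. Their countable union is
   negligible and contains every path that reaches the goal, so the reward is almost surely
   infinite. *)
pose F (n : nat) : set (path_space M) :=
  if unpickle n is Some w then if null w then cylinder w else set0 else set0.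
have negF : mu.-negligible (\bigcup_n F n).
  apply: negligible_bigcup => n; rewrite /F.
  case: unpickle => [w|]; last exact: negligible_set0.
  have [/eqP w0|_] := boolP (null w); last exact: negligible_set0.
  apply/negligibleP; first exact: measurable_cylinder.
  by apply: etrans (path_measureP _ _ w) _; rewrite w0.
rewrite /expected (@ae_eq_integral _ _ _ mu setT (cst +oo%E))//.
- by rewrite integral_cst// [X in (_ * X)%E]probability_setT mule1.
- exact: measurable_reach_reward.
apply: negligibleS negF => omega /=; apply: contra_notP => nF _.
apply: reach_reward_never => -[n nG]; apply: nF.
have nC : ~~ C (path_state s omega n) by apply/negP => /CG; rewrite nG.
case: n nG nC => [|n] nG nC; first by rewrite /= Cs in nC.
exists (pickle (mkseq omega n.+1)) => //; rewrite /F pickleK.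
have -> : null (mkseq omega n.+1).
  apply/eqP; apply: (word_prob_leave Cclosed) => //.
  apply: contra nC => /allP; apply.
  by apply/mapP; exists (omega n) => //; apply/mapP; exists n; rewrite ?mem_iota/=.
by rewrite /cylinder/= size_map size_iota.
Qed.

(** The test on [h] confines [b] to the first move: later visits to [s0] follow [sigma] again, as
    [expected_first_step] requires. *)
Definition deviate_fun (s0 : state M) (b : action M) s (h : seq (step M)) :
    action M :=
  if (h == [::]) && (s == s0) then b else sigma (last_state s h).

Program Definition deviate s0 b (b_en : b \in enabled s0) : strategy M :=
  @Strategy _ _ (fun s h a => (a == deviate_fun s0 b s h)%:R) _ _ _.
Next Obligation. by []. Qed.
Next Obligation.
move=> s0 b _ s h; rewrite (bigD1 (deviate_fun s0 b s h))//= eqxx big1 ?addr0//.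
by move=> a /negbTE ->.
Qed.
Next Obligation.
move=> s0 b b_en s h a; apply: contraNeq.
rewrite pnatr_eq0 eqb0 negbK => /eqP ->; rewrite /deviate_fun.
by case: ifP => [/andP[/eqP-> /eqP->]|_]//; exact: ps_enabled.
Qed.

Lemma sum_step_dirac s b (F : action M -> state M -> R) :
  \sum_(e : step M) (e.1 == b)%:R * trans s e.1 e.2 * F e.1 e.2 =
  \sum_t trans s b t * F b t.
Proof.
rewrite -(pair_bigA _ (fun a t => (a == b)%:R * trans s a t * F a t))/=.
rewrite (bigD1 b)//= [X in _ + X]big1 ?addr0.
  by apply: eq_bigr => t _; rewrite eqxx mul1r.
by move=> a /negbTE ab; rewrite big1// => t _; rewrite ab !mul0r.
Qed.

Section finite.
Variable psi : objective M.
Hypothesis sigma_fin :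
  forall s, (expected (strategy_of_ps sigma) s psi < +oo)%E.

Definition value s : R := fine (expected (strategy_of_ps sigma) s psi).

Lemma valueE s : expected (strategy_of_ps sigma) s psi = (value s)%:E.
Proof. by rewrite /value fineK// ge0_fin_numE ?expected_ge0. Qed.

Lemma value_ge0 s : 0 <= value s.
Proof. by rewrite -lee_fin -valueE expected_ge0. Qed.

Lemma value_zero s : S_zero psi s -> value s = 0.
Proof. by move=> s0; rewrite /value s0. Qed.

Let expected_step tau s b : s \notin goal psi ->
  (forall e h, step_prob tau s (e :: h) = step_prob (strategy_of_ps sigma) e.2 h) ->
  (forall a, tau s [::] a = (a == b)%:R) ->
  expected tau s psi =
  (\sum_t trans s b t * (value t + reward psi s b t))%:E.
Proof.
move=> sG after tau0; rewrite (expected_first_step after sG).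
under eq_bigr do rewrite /step_prob tau0 valueE -EFinD -EFinM.
rewrite sumEFin (sum_step_dirac s b
  (fun a t => reward psi s a t + value t)).
by congr _%:E; apply: eq_bigr => t _; rewrite [in RHS]addrC.
Qed.

Lemma value_step s : s \notin goal psi ->
  value s = \sum_t trans s (sigma s) t * (value t + reward psi s (sigma s) t).
Proof. by move=> sG; apply: EFin_inj; rewrite -valueE; exact: expected_step. Qed.

Lemma expected_deviate s b (b_en : b \in enabled s) : s \notin goal psi ->
  expected (deviate b_en) s psi =
  (\sum_t trans s b t * (value t + reward psi s b t))%:E.
Proof.
by move=> sG; apply: expected_step => // a; rewrite /= /deviate_fun !eqxx.
Qed.

(* At a positive maximum the inequality forces all successors to be maximal, *)
(* so the maximizers form a trap that avoids the goal.                       *)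
Lemma max_principle (K : set (state M)) (d : state M -> R) :
  (forall s, K s -> s \notin goal psi) ->
  (forall s, K s -> d s <= \sum_t trans s (sigma s) t * d t) ->
  (forall s t, K s -> 0 < trans s (sigma s) t -> ~ K t -> d t <= 0) ->
  forall s, K s -> d s <= 0.
Proof.
move=> KG dsub dout s0 Ks0; rewrite leNgt; apply/negP => ds0.
have K0 : `[< K s0 >] by apply/asboolP.
case: (@arg_maxP _ _ _ s0 (fun s => `[< K s >]) d K0) => m /asboolP Km mmax.
have dm0 : 0 < d m by apply: lt_le_trans ds0 (mmax _ K0).
have := sigma_fin m; rewrite (@expected_trap _ (fun s => `[< K s >] && (d s == d m))) ?ltxx//.
- move=> s t /andP[/asboolP Ks /eqP ds] st.
  have dle u : 0 < trans s (sigma s) u -> d u <= d m.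
    have [Ku _|nKu su] := pselect (K u); first by apply: mmax; apply/asboolP.
    exact: le_trans (dout _ _ Ks su nKu) (ltW dm0).
  have term_ge0 u : 0 <= trans s (sigma s) u * (d m - d u).
    have := trans_ge0 s (sigma s) u; rewrite le_eqVlt => /orP[/eqP<-|su].
      by rewrite mul0r.
    by rewrite mulr_ge0 ?trans_ge0// subr_ge0 dle.
  (* The gaps to the maximum are nonnegative and their average is at most 0, so each gap of positive
     weight is 0. *)
  have sum_le0 : \sum_u trans s (sigma s) u * (d m - d u) <= 0.
    under eq_bigr do rewrite mulrBr.
    rewrite sumrB -mulr_suml trans_sum1 ?ps_enabled// mul1r subr_le0 -ds.
    exact: dsub.
  have : trans s (sigma s) t * (d m - d t) <= 0.
    by apply: le_trans sum_le0; rewrite (bigD1 t)//= lerDl sumr_ge0.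
  rewrite pmulr_rle0// subr_le0 => dt.
  have edt : d t = d m by apply/eqP; rewrite eq_le dt dle.
  rewrite edt eqxx andbT; apply/asboolP; apply: contrapT => nKt.
  by have := dout _ _ Ks st nKt; rewrite edt leNgt dm0.
- by move=> s /andP[/asboolP Ks _]; exact: KG.
- by rewrite eqxx andbT; apply/asboolP.
Qed.

End finite.
End stationary.

Lemma sum_const_but_one (R : pzRingType) (T : finType) (A : {set T}) x (c : R) :
  x \in A -> \sum_(y in A | y != x) c = (#|A|%:R - 1) * c.
Proof.
move=> xA; rewrite mulrBl mul1r mulr_natl -sumr_const (bigD1 x xA)/=.
by rewrite addrAC subrr add0r.
Qed.

(** * Boundary of the unknown states *)

Section unknown_states.
Variables (R : realType) (M : mdp R) (psi : objective M).

Lemma S_unknown_goal (s : state M) : S_unknown psi s -> s \notin goal psi.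
Proof.
move=> [ns0 _]; apply/negP => sG; apply: ns0 => sigma; exact: expected_goal.
Qed.

Lemma S_unknown_init : ~ S_zero psi (init M) -> S_unknown psi (init M).
Proof.
by move=> ni; split=> //; exists [::]; split=> // t; rewrite inE => /eqP ->.
Qed.

(** Otherwise appending [t] to the path witnessing [s] would make [t] unknown. Hence [S_unknown] can
    only be left into [S_zero], where both [x] and the value are 0. *)
Lemma S_unknown_succ (s t : state M) b :
  S_unknown psi s -> 0 < trans s b t -> ~ S_unknown psi t -> S_zero psi t.
Proof.
move=> [_ [w [pw lw wN]]] st; apply: contra_notP => nt; split=> //.
exists (rcons w t); split; last 1 first.
- move=> u; rewrite -rcons_cons mem_rcons inE => /orP[/eqP->//|]; exact: wN.
- by rewrite rcons_path pw lw; apply/existsP; exists b.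
- by rewrite last_rcons.
Qed.

End unknown_states.

(** * Solutions of C1 versus achieving strategies *)

Section constraints.
Variables (R : realType) (M : mdp R) (l : nat) (Q : 'I_l -> objective M).
Variables (p : 'I_l -> R) (U : 'I_l -> state M -> rat).
Hypothesis finite_ps : forall (j : 'I_l) (s : state M) (sigma : ps_strategy M),
  (expected (strategy_of_ps sigma) s (Q j) < +oo)%E.

Lemma C1_select_ps (a : state M -> action M -> R) :
  (forall s b, b \in enabled s -> a s b = 0 \/ a s b = 1) ->
  (forall s, \sum_(b in enabled s) a s b = 1) ->
  exists sigma : ps_strategy M, forall s b,
    b \in enabled s -> a s b = (b == sigma s)%:R.
Proof.
move=> a01 asum.
have ex s : exists2 b, b \in enabled s & a s b = 1.
  apply: contrapT => nex; have := asum s; rewrite big1 => [/esym/eqP|b ben].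
    by rewrite oner_eq0.
  by have [//|ab] := a01 s b ben; case: nex; exists b.
pose f s := sval (cid2 (ex s)).
have f_en s : f s \in enabled s by rewrite /f; case: cid2.
have af s : a s (f s) = 1 by rewrite /f; case: cid2.
exists (PSStrategy f_en) => s b ben /=; case: eqP => [->//|/eqP bf].
have [//|ab] := a01 s b ben; have := asum s.
(* A second action with value 1 would push the sum to at least 2. *)
rewrite (bigD1 (f s))//= af (bigD1 b) ?ben//= ab => s1.
suff : 0 <= \sum_(i in enabled s | (i != f s) && (i != b)) a s i.
  by move: s1; under eq_bigl do rewrite -andbA; lra.
apply: sumr_ge0 => c /andP[cen _].
by have [->|->] := a01 s c cen.
Qed.

(* For a minimizing objective the slack U of each of the |Act(s)| - 1 actions *)
(* that are not selected cancels the term added in C1_sum.                    *)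
Lemma C1_solution_bellman a x xa (sigma : ps_strategy M) :
  C1_solution Q p U a x xa ->
  (forall s b, b \in enabled s -> a s b = (b == sigma s)%:R) ->
  forall j s, S_unknown (Q j) s ->
  x j s <= \sum_t trans s (sigma s) t *
    (x j t + cmp_eps R (obj_cmp (Q j)) * reward (Q j) s (sigma s) t).
Proof.
move=> sol aE j s us; have sen := ps_enabled sigma s.
apply: le_trans (C1_step sol us sen).
have := C1_sum sol us; rewrite (bigD1 (sigma s))//=.
set mu := cmp_mu R _; set u := ratr (U j s) => xs.
suff : \sum_(b in enabled s | b != sigma s) xa j s b <=
    - (mu * (#|enabled s|%:R - 1) * u) by lra.
have -> : - (mu * (#|enabled s|%:R - 1) * u) =
    \sum_(b in enabled s | b != sigma s) (- mu * u).
  by rewrite sum_const_but_one//; ring.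
apply: ler_sum => b /andP[ben bs]; apply: le_trans (C1_select sol us ben) _.
by rewrite aE// (negbTE bs) sub0r -/mu -/u mulrC.
Qed.

Lemma C1_solution_achievable a x xa :
  C1_solution Q p U a x xa -> achievable_ps Q p.
Proof.
move=> sol; have [sigma aE] := C1_select_ps (C1_bool sol) (C1_one sol).
exists sigma => j; pose v := value sigma (Q j).
have fin s : (expected (strategy_of_ps sigma) s (Q j) < +oo)%E by exact: finite_ps.
have xle := C1_solution_bellman sol aE (j := j).
pose eps := cmp_eps R (obj_cmp (Q j)).
(* The reward terms cancel in the difference of the two Bellman relations, leaving a subharmonic
   function. *)
have d_le0 s : S_unknown (Q j) s -> x j s - eps * v s <= 0.
  apply: (max_principle fin (K := S_unknown (Q j)) (d := fun s => x j s - eps * v s)).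
  - by move=> t; exact: S_unknown_goal.
  - move=> t ut; rewrite /v (value_step fin (S_unknown_goal ut)) -/v.
    apply: le_trans (lerB (xle _ ut) (lexx _)) _.
    rewrite mulr_sumr -sumrB ler_sum// => u _; rewrite -/eps.
    by rewrite le_eqVlt; apply/orP; left; apply/eqP; ring.
  - move=> t u ut tu nu; have u0 := S_unknown_succ ut tu nu.
    by rewrite /v value_zero// (C1_zero sol u0) mulr0 subrr.
have {}d_le0 : x j (init M) - eps * v (init M) <= 0.
  have [i0|/S_unknown_init ui] := pselect (S_zero (Q j) (init M)); last exact: d_le0.
  by rewrite /v value_zero// (C1_zero sol i0) mulr0 subrr.
have := C1_point sol j; rewrite (valueE fin) -/v.
by move: d_le0; rewrite /eps /cmp_holds; case: obj_cmp => /=; rewrite lee_fin; lra.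
Qed.

Hypothesis U_bound : forall (j : 'I_l) (s : state M), S_unknown (Q j) s ->
  forall sigma : strategy M, (expected sigma s (Q j) <= (ratr (U j s))%:E)%E.

Lemma achievable_C1_solution : achievable_ps Q p ->
  exists a x xa, C1_solution Q p U a x xa.
Proof.
move=> [sigma ach]; pose v j := value sigma (Q j).
have fin j s : (expected (strategy_of_ps sigma) s (Q j) < +oo)%E by exact: finite_ps.
have v0 j s : 0 <= v j s by exact: value_ge0.
pose eps j := cmp_eps R (obj_cmp (Q j)).
pose mu j := cmp_mu R (obj_cmp (Q j)).
have vU j s : S_unknown (Q j) s -> v j s <= ratr (U j s).
  by move=> us; rewrite -lee_fin -valueE// U_bound.
(* For actions not selected, [C1_bounda] and [C1_select] force the value of [xa]: 0 when maximizing,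
   [-U] when minimizing. *)
exists (fun s b => (b == sigma s)%:R), (fun j s => eps j * v j s),
  (fun j s b => if b == sigma s then eps j * v j s else - mu j * ratr (U j s)).
split=> [s b _|s|j s s0|j s us|j s b us ben|j s b us ben|j s b us ben|j s us|j].
- by case: eqP; [right|left].
- rewrite (bigD1 (sigma s)) ?ps_enabled//= eqxx big1 ?addr0//.
  by move=> b /andP[_ /negbTE->].
- by rewrite /v value_zero// mulr0.
- have := v0 j s; have := vU j s us.
  by rewrite /eps; case: obj_cmp => /= *; apply/andP; split; lra.
- have := v0 j s; have := vU j s us.
  by rewrite /eps /mu; case: eqP => _; case: obj_cmp => /= *; apply/andP; split; lra.
- have sG := S_unknown_goal us.
  have -> : \sum_t trans s b t * (eps j * v j t + eps j * reward (Q j) s b t) =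
      eps j * \sum_t trans s b t * (v j t + reward (Q j) s b t).
    by rewrite mulr_sumr; apply: eq_bigr => t _; ring.
  case: eqP => [->|_]; first by rewrite /v (value_step (fin j) sG).
  have S0 : 0 <= \sum_t trans s b t * (v j t + reward (Q j) s b t).
    apply: sumr_ge0 => t _.
    by rewrite mulr_ge0 ?trans_ge0// addr_ge0 ?v0 ?reward_ge0.
  (* The sum is the expected reward of a deviation to [b], a history-dependent strategy, which [U]
     bounds too. *)
  have SU : \sum_t trans s b t * (v j t + reward (Q j) s b t) <= ratr (U j s).
    by rewrite -lee_fin -(expected_deviate (fin j) ben sG) U_bound.
  by rewrite /eps /mu; case: obj_cmp => /=; lra.
- have := v0 j s; have := vU j s us.
  by rewrite /eps /mu; case: eqP => _; case: obj_cmp => /= *; lra.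
- have sen := ps_enabled sigma s.
  rewrite (bigD1 (sigma s))//= eqxx -addrA lerDl.
  rewrite (eq_bigr (fun=> - mu j * ratr (U j s))); last first.
    by move=> b /andP[_ /negbTE->].
  rewrite sum_const_but_one//.
  by rewrite le_eqVlt; apply/orP; left; apply/eqP; rewrite /mu; ring.
- have := ach j; rewrite (valueE (fin j)) -/(v j) /eps /cmp_holds.
  by case: obj_cmp => /=; rewrite lee_fin; lra.
Qed.

End constraints.

Theorem theorem2 (R : realType) (M : mdp R) (l : nat) (Q : 'I_l -> objective M)
    (p : 'I_l -> R) (U : 'I_l -> state M -> rat)
    (one_ec : exists! E : {set state M * action M}, end_component E)
    (finite_ps : forall (j : 'I_l) (s : state M) (sigma : ps_strategy M),
       (expected (strategy_of_ps sigma) s (Q j) < +oo)%E)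
    (U_bound : forall (j : 'I_l) (s : state M), S_unknown (Q j) s ->
       forall sigma : strategy M,
         (expected sigma s (Q j) <= (ratr (U j s))%:E)%E) :
  (exists (a : state M -> action M -> R) (x : 'I_l -> state M -> R)
          (xa : 'I_l -> state M -> action M -> R),
     C1_solution Q p U a x xa)
  <-> achievable_ps Q p.
Proof.
split=> [[a [x [xa sol]]]|]; first exact: (C1_solution_achievable finite_ps sol).
exact: achievable_C1_solution.
Qed.
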